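(* Let $n, k \ge 0$ be integers. Any multiplicative sublattice of co-rank $k$ in $\mathbb{Z}^{n+k}$ is of the form $g(L)$, where $g : \mathbb{Z}^n \to \mathbb{Z}^{n+k}$ is an acceptable map and $L$ is a multiplicative sublattice of full rank in $\mathbb{Z}^n$.
   Context: $\mathbb{Z}^n$ is the ring of $n$-tuples of integers with componentwise addition and multiplication. A sublattice of $\mathbb{Z}^n$ is a $\mathbb{Z}$-submodule $L \subseteq \mathbb{Z}^n$; its co-rank is $n - \operatorname{rank}_{\mathbb{Z}} L$, and it has full rank if its rank is $n$. A sublattice $L$ is multiplicative if $u \cdot v \in L$ for all $u,v \in L$ (it is not required to contain the identity $(1,\dots,1)$). An acceptable map is an injective map $g : \mathbb{Z}^n \to \mathbb{Z}^{n+k}$ of the form $g(x_1,\dots,x_n) = (y_1,\dots,y_{n+k})$ in which each coordinate $y_j$ is either identically $0$ or equal to $x_i$ for some fixed index $i$ depending only on $j$ (and $g$). *)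

(* Defs.v *)
From mathcomp Require Import all_boot all_order all_algebra.
From mathcomp Require Import classical_sets.

Set Implicit Arguments.
Unset Strict Implicit.
Unset Printing Implicit Defensive.

Import Order.TTheory GRing.Theory Num.Theory.
Local Open Scope classical_set_scope.
Local Open Scope ring_scope.

(* The library equips [{ffun 'I_n -> int}] with the pointwise ring structure,
   for every n, n = 0 included. *)
Notation Zn n := {ffun 'I_n -> int}.

Definition is_sublattice (n : nat) (L : set (Zn n)) : Prop :=
  [/\ L 0,
      forall u v, L u -> L v -> L (u + v) &
      forall (a : int) u, L u -> L (u *~ a)].

Definition is_multiplicative (n : nat) (L : set (Zn n)) : Prop :=
  forall u v, L u -> L v -> L (u * v).

Definition multiplicative_sublattice (n : nat) (L : set (Zn n)) : Prop :=
  is_sublattice L /\ is_multiplicative L.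

Definition Zindependent (n r : nat) (v : 'I_r -> Zn n) : Prop :=
  forall c : 'I_r -> int, \sum_(i < r) v i *~ c i = 0 -> forall i, c i = 0.

(* The rank over the integers is the largest size of a linearly independent
   family of elements of L. *)
Definition has_rank (n : nat) (L : set (Zn n)) (r : nat) : Prop :=
  (exists2 v : 'I_r -> Zn n, Zindependent v & forall i, L (v i)) /\
  (forall (s : nat) (v : 'I_s -> Zn n),
     Zindependent v -> (forall i, L (v i)) -> (s <= r)%N).

(* The addition avoids truncated subtraction in k = n - r. *)
Definition has_corank (n : nat) (L : set (Zn n)) (k : nat) : Prop :=
  exists2 r, has_rank L r & (r + k = n)%N.

Definition full_rank (n : nat) (L : set (Zn n)) : Prop := has_rank L n.

Definition acceptable (n m : nat) (g : Zn n -> Zn m) : Prop :=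
  injective g /\
  forall j : 'I_m,
    (forall x, g x j = 0) \/ (exists i : 'I_n, forall x, g x j = x i).

(* Main.v *)
(* Two coordinates that agree on all of [M] are merged and coordinates that
   vanish on [M] are dropped; let [d] coordinates remain.  Restriction to them is
   injective on [M], so rank M <= d.  Conversely, if [t i != 0] and
   [u i != u j] with [t, u] in [M], then [t * u - u j * t] lies in [M], vanishes
   at [j] and not at [i]; iterating over [j] gives, for each remaining coordinate
   [i], an element of [M] supported at [i] only among the remaining ones, so
   d <= rank M. *)
Require Import Defs.
From mathcomp Require Import all_boot all_order all_algebra.
From mathcomp Require Import boolp classical_sets.

Set Implicit Arguments.
Unset Strict Implicit.
Unset Printing Implicit Defensive.

Import Order.TTheory GRing.Theory Num.Theory.
Local Open Scope classical_set_scope.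
Local Open Scope ring_scope.

Lemma common_denominator (I : finType) (c : I -> rat) :
  exists2 D : int, D != 0 & exists e : I -> int, forall i, (e i)%:~R = D%:~R * c i.
Proof.
exists (\prod_i denq (c i)); first by apply/prodf_neq0 => i _; exact: denq_neq0.
exists (fun i => numq (c i) * \prod_(j | j != i) denq (c j)) => i.
rewrite [in RHS](bigD1 i) //= !rmorphM /= mulrAC; congr (_ * _).
by rewrite numqE mulrC.
Qed.

Lemma sum_ffun_mulrz (m s : nat) (v : 'I_s -> Zn m) (c : 'I_s -> int) j :
  (\sum_i v i *~ c i) j = \sum_i v i j * c i.
Proof. by rewrite sum_ffunE; apply: eq_bigr => i _; rewrite ffunMzE mulrzz. Qed.

(** If [d < s], the matrix with rows [v i] has a nonzero left kernel vector over the rationals;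
    clearing its denominators gives a nontrivial integer relation. *)
Lemma Zindependent_leq (d s : nat) (v : 'I_s -> Zn d) :
  Zindependent v -> (s <= d)%N.
Proof.
move=> indep; rewrite leqNgt; apply/negP => lt_ds.
pose A : 'M[rat]_(s, d) := \matrix_(i, j) (v i j)%:~R.
have : kermx A != 0.
  rewrite -mxrank_eq0 mxrank_ker subn_eq0 -ltnNge.
  exact: leq_ltn_trans (rank_leq_col A) lt_ds.
case/rowV0Pn => c /sub_kermxP cA0 /rV0Pn[i0 ci0].
have [D D0 [e eE]] := common_denominator (fun i => c 0 i).
have e0 : forall i, e i = 0.
  apply: indep; apply/ffunP => j; rewrite sum_ffun_mulrz ffunE.
  apply/eqP; rewrite -(intr_eq0 rat) rmorph_sum /=; apply/eqP.
  transitivity (D%:~R * (c *m A) 0 j); last by rewrite cA0 mxE mulr0.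
  rewrite mxE big_distrr /=; apply: eq_bigr => i _.
  by rewrite mxE rmorphM /= eE mulrC mulrA.
have /eqP := eE i0; rewrite e0 eq_sym mulf_eq0 intr_eq0 (negPf D0) /=.
by rewrite (negPf ci0).
Qed.

Definition agree_on (m : nat) (M : set (Zn m)) (i j : 'I_m) : Prop :=
  forall u, M u -> u i = u j.

(** Agreement on [M] is an equivalence relation on coordinates; [R] takes the least index of each
    class on which [M] does not vanish. *)
Lemma coordinate_representatives (m : nat) (M : set (Zn m)) :
  exists R : {set 'I_m},
    [/\ {in R, forall i, exists2 u, M u & u i != 0},
        {in R &, forall i j, agree_on M i j -> i = j} &
        forall j, (forall u, M u -> u j = 0) \/
                  exists2 i, i \in R & agree_on M i j].
Proof.
pose nz i := `[< exists2 u, M u & u i != 0 >].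
pose least i := [forall j : 'I_m, `[< agree_on M j i >] ==> (i <= j)%N].
exists [set i | nz i && least i]%SET; split.
- by move=> i; rewrite inE => /andP[/asboolP].
- move=> i j; rewrite !inE => /andP[_ /forallP li] /andP[_ /forallP lj] ij.
  apply/val_inj/anti_leq/andP; split.
    by apply: (implyP (li j)); apply/asboolP => u Mu; rewrite ij.
  by apply: (implyP (lj i)); apply/asboolP.
- move=> j; have [[w Mw wj]|z] := pselect (exists2 u, M u & u j != 0); last first.
    by left=> u Mu; apply: contrapT => /eqP uj; apply: z; exists u.
  right; have jj : `[< agree_on M j j >] by apply/asboolP.
  case: (@arg_minnP _ j (fun i => `[< agree_on M i j >]) val jj) => i /asboolP ij imin.
  exists i => //; rewrite inE; apply/andP; split.
    by apply/asboolP; exists w; rewrite ?ij.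
  apply/forallP => l; apply/implyP => /asboolP li; apply: imin.
  by apply/asboolP => u Mu; rewrite li ?ij.
Qed.

Lemma isolating_element (m : nat) (M : set (Zn m)) (i : 'I_m) (s : seq 'I_m) :
  multiplicative_sublattice M -> (exists2 u, M u & u i != 0) ->
  {in s, forall j, ~ agree_on M i j} ->
  exists w, [/\ M w, w i != 0 & {in s, forall j, w j = 0}].
Proof.
move=> [[M0 MD MZ] MM] [t0 Mt0 t0i].
elim: s => [|j s IHs] sep; first by exists t0.
have [|t [Mt ti ts]] := IHs.
  by move=> l ls; apply: sep; rewrite inE ls orbT.
have [u Mu uij] : exists2 u, M u & u i != u j.
  apply: contrapT => nex; apply: (sep j (mem_head _ _)) => u Mu.
  by apply: contrapT => /eqP uij; apply: nex; exists u.
(* The constant tuple [u j] need not lie in [M], but its product with [t] is an integer multiple of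
   [t]. The factor [t l] preserves the zeros already obtained. *)
have wE l : (t * u + t *~ - u j) l = t l * (u l - u j).
  by rewrite !ffunE ffunMzE mulrzz mulrN mulrBr.
exists (t * u + t *~ - u j); split.
- by apply: MD; [exact: MM|exact: MZ].
- by rewrite wE mulf_neq0 // subr_eq0.
- move=> l; rewrite inE wE => /orP[/eqP ->|ls]; first by rewrite subrr mulr0.
  by rewrite ts // mul0r.
Qed.

Lemma card_representatives_leq (m n : nat) (M : set (Zn m)) (R : {set 'I_m}) :
  multiplicative_sublattice M -> has_rank M n ->
  {in R, forall i, exists2 u, M u & u i != 0} ->
  {in R &, forall i j, agree_on M i j -> i = j} ->
  (#|R| <= n)%N.
Proof.
move=> mM [_ rank_max] Rnz Rsep.
have iso (a : 'I_#|R|) : exists w, [/\ M w, w (enum_val a) != 0 &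
    forall b : 'I_#|R|, b != a -> w (enum_val b) = 0].
  have [|w [Mw wa ws]] :=
    isolating_element (s := enum (R :\ enum_val a)%SET) mM (Rnz _ (enum_valP a)).
    move=> j; rewrite mem_enum !inE => /andP[ja jR] aj.
    by move: ja; rewrite (Rsep _ _ (enum_valP a) jR aj) eqxx.
  exists w; split=> // b ba; apply: ws.
  by rewrite mem_enum !inE enum_valP andbT (inj_eq enum_val_inj).
have [w wP] := choice iso.
apply: (rank_max _ w) => [c c0 a|a]; last by case: (wP a).
(* At the representative [a] every term of the relation but the one of index [a] vanishes. *)
have /eqP := congr1 (fun f : Zn m => f (enum_val a)) c0.
rewrite sum_ffun_mulrz ffunE (bigD1 a) //= big1 ?addr0 => [|b ba].
  by case: (wP a) => _ /negPf wa _; rewrite mulf_eq0 wa => /eqP.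
by case: (wP b) => _ _ -> //; rewrite ?mul0r // eq_sym.
Qed.

Lemma leq_card_representatives (m n : nat) (M : set (Zn m)) (R : {set 'I_m}) :
  is_sublattice M -> has_rank M n ->
  (forall j, (forall u, M u -> u j = 0) \/
             exists2 i, i \in R & agree_on M i j) ->
  (n <= #|R|)%N.
Proof.
move=> [M0 MD MZ] [[v indep Mv] _] Rcov.
pose v' a : Zn #|R| := [ffun b => v a (enum_val b)].
apply: (Zindependent_leq (v := v')) => c c0; apply: indep.
(* Since the combination lies in [M], its vanishing on [R] forces it to vanish at every
   coordinate. *)
have Ms : M (\sum_i v i *~ c i).
  by apply: (big_ind M) => // i _; apply: MZ.
apply/ffunP => j; rewrite [RHS]ffunE.
have [->//|[i iR <- //]] := Rcov j.
have := congr1 (fun f : Zn #|R| => f (enum_rank_in iR i)) c0.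
rewrite /= !sum_ffun_mulrz ffunE => s0; rewrite -[RHS]s0; apply: eq_bigr => a _.
by rewrite ffunE enum_rankK_in.
Qed.

Theorem theorem8 (n k : nat) (M : set (Zn (n + k))) :
  multiplicative_sublattice M -> has_corank M k ->
  exists (g : Zn n -> Zn (n + k)) (L : set (Zn n)),
    [/\ acceptable g, multiplicative_sublattice L, full_rank L & M = g @` L].
Proof.
move=> mM [r rkM /addIn rn]; rewrite {r}rn in rkM.
have [R [Rnz Rsep Rcov]] := coordinate_representatives M.
have [[M0 MD MZ] MM] := mM.
have nR : n = #|R|.
  apply/anti_leq/andP; split; first exact: (leq_card_representatives mM.1 rkM).
  exact: (card_representatives_leq mM rkM).
pose f (i : 'I_n) := enum_val (cast_ord nR i).
have f_onto j : j \in R -> exists i, f i = j.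
  move=> jR; exists (cast_ord (esym nR) (enum_rank_in jR j)).
  by rewrite /f cast_ordKV enum_rankK_in.
(* [Some i] means that coordinate [j] copies the representative [f i]; [None] means that [M]
   vanishes at [j]. *)
pose source j o := if o is Some i then agree_on M (f i) j else forall u, M u -> u j = 0.
have /choice[h hP] j : exists o, source j o.
  have [z|[i iR ij]] := Rcov j; first by exists None.
  by have [a fa] := f_onto i iR; exists (Some a); rewrite /= fa.
(* A representative can only be its own source, so [x] can be read off [g x] at the coordinates
   [f i]; this yields injectivity of [g]. *)
have hf i : h (f i) = Some i.
  have fR a : f a \in R by apply: enum_valP.
  have := hP (f i); rewrite /source; case: (h (f i)) => [a|z].
    by move/(Rsep _ _ (fR a) (fR i))/enum_val_inj/cast_ord_inj ->.
  by have [u Mu /eqP] := Rnz _ (fR i); case; apply: z.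
pose g (x : Zn n) : Zn (n + k) := [ffun j => if h j is Some i then x i else 0].
have gD : {morph g : x y / x + y}.
  by move=> x y; apply/ffunP => j; rewrite !ffunE; case: (h j) => [a|]; rewrite ?ffunE ?addr0.
have gM : {morph g : x y / x * y}.
  by move=> x y; apply/ffunP => j; rewrite !ffunE; case: (h j) => [a|]; rewrite ?ffunE ?mulr0.
have g0 : g 0 = 0.
  by apply/ffunP => j; rewrite !ffunE; case: (h j) => [a|]; rewrite ?ffunE.
have gZ x c : g (x *~ c) = g x *~ c.
  apply/ffunP => j; rewrite ffunMzE !ffunE.
  by case: (h j) => [a|]; rewrite ?ffunMzE ?mul0rz.
have g_inj : injective g.
  move=> x y gxy; apply/ffunP => i.
  by have := congr1 (fun u : Zn _ => u (f i)) gxy; rewrite !ffunE hf.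
have g_restr u : M u -> g [ffun i => u (f i)] = u.
  move=> Mu; apply/ffunP => j; rewrite ffunE.
  have := hP j; rewrite /source; case: (h j) => [a aj|z]; first by rewrite ffunE aj.
  by rewrite z.
(* [L] is the preimage of [M]; it inherits closure because [g] respects sums, products and integer
   multiples. *)
exists g, (fun x => M (g x)); split.
- split=> // j; case hj : (h j) => [a|].
    by right; exists a => x; rewrite ffunE hj.
  by left=> x; rewrite ffunE hj.
- split; first split.
  + by rewrite g0.
  + by move=> u v Lu Lv; rewrite gD; apply: MD.
  + by move=> a u Lu; rewrite gZ; apply: MZ.
  + by move=> u v Lu Lv; rewrite gM; apply: MM.
- split; last by move=> s v /Zindependent_leq.
  have [[v indep Mv] _] := rkM.
  (* An independent family of size [n] in [M] is restricted to the representatives; applying [g]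
     turns any relation among the restrictions into the same relation among the [v a]. *)
  exists (fun a => [ffun i => v a (f i)]); last by move=> a; rewrite g_restr.
  move=> c c0; apply: indep.
  have := congr1 g c0; rewrite g0 (big_morph g gD g0) => gc0; rewrite -[RHS]gc0.
  by apply: eq_bigr => a _; rewrite gZ g_restr.
- apply/seteqP; split=> [u Mu|u [x Lx <-] //].
  by exists [ffun i => u (f i)]; rewrite g_restr.
Qed.
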